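(* Let $d\ge3$ and let $K:\mathbb{S}^{d-1}\times\mathbb{S}^{d-1}\to\mathbb{C}$ be a Hermitian, axially symmetric kernel of the form $$K(\xi,\zeta)=\sum_{\ell_1=-\infty}^{\infty}\ \sum_{\ell,\ell'\in\Lambda_{|\ell_1|}}c_{\ell_1}(\ell,\ell')\,Y_{\ell_1,\ell}(\xi)\,\overline{Y_{\ell_1,\ell'}(\zeta)},\qquad \xi,\zeta\in\mathbb{S}^{d-1},$$ with $$\sum_{\ell_1=-\infty}^{\infty}\ \sum_{\ell,\ell'\in\Lambda_{|\ell_1|}}|c_{\ell_1}(\ell,\ell')|\,\frac{\sqrt{N_{\ell_{d-1},d}N_{\ell'_{d-1},d}}}{\sigma_{d-1}}<\infty .$$ For each $\ell_1\in\mathbb{Z}$ let $\alpha\mapsto\ell^{(\alpha)}=(\ell_2^{(\alpha)},\ldots,\ell_{d-1}^{(\alpha)})$, $\alpha=1,2,\ldots$, be a bijective enumeration of $\Lambda_{|\ell_1|}$ with $\ell_{d-1}^{(\alpha')}\le\ell_{d-1}^{(\alpha)}$ whenever $\alpha'<\alpha$, and for each integer $k\ge1$ let $$A_{\ell_1}^k=\left(c_{\ell_1}(\ell^{(\alpha)},\ell^{(\alpha')})\right)_{\alpha,\alpha'=1}^{k}.$$ If the matrix $A_{\ell_1}^k$ is positive semi-definite for all $\ell_1\in\mathbb{Z}$ and all $k\ge 1$, then $K$ is positive definite on $\mathbb{S}^{d-1}$.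
   Context: A Hermitian kernel $K:\Omega\times\Omega\to\mathbb{C}$ ($K(x,y)=\overline{K(y,x)}$) is called positive definite on $\Omega$ if for every finite set $\Xi\subset\Omega$ of distinct points the matrix $(K(\xi,\zeta))_{\xi,\zeta\in\Xi}$ is positive semi-definite on $\mathbb{C}^{|\Xi|}$. $\mathbb{S}^{d-1}$ is the unit sphere in $\mathbb{R}^d$ and $\sigma_{d-1}$ its surface area. $N_{0,d}=1$, $N_{j,d}=\frac{(2j+d-2)(j+d-3)!}{j!(d-2)!}$ for $j\ge1$. For $\ell_1\in\mathbb{Z}$, $\Lambda_{|\ell_1|}=\{\ell=(\ell_2,\ldots,\ell_{d-1})\in\mathbb{Z}^{d-2}:|\ell_1|\le\ell_2\le\cdots\le\ell_{d-1}\}$. In polar coordinates $\xi=(\theta_1,\ldots,\theta_{d-1})$, $\theta_1\in[0,2\pi)$, $\theta_j\in[0,\pi]$ for $j\ge2$ ($\xi_d=\cos\theta_{d-1}$, $\xi_{d-1}=\sin\theta_{d-1}\cos\theta_{d-2}$, ..., $\xi_2=\sin\theta_{d-1}\cdots\sin\theta_2\sin\theta_1$, $\xi_1=\sin\theta_{d-1}\cdots\sin\theta_2\cos\theta_1$), the functions $$Y_{\ell_1,\ell}(\xi)=Y_{\ell_1,\ldots,\ell_{d-1}}(\xi)=\frac{1}{\sqrt{2\pi}}e^{i\ell_1\theta_1}\prod_{j=2}^{d-1}{}_{j}\tilde P_{\ell_j}^{\ell_{j-1}}(\theta_j)$$ form an orthonormal basis of $L^2(\mathbb{S}^{d-1})$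 of spherical harmonics ($Y_{\ell_1,\ell}$ has degree $\ell_{d-1}$), where ${}_{j}\tilde P_{L}^{\ell}(\theta)={}_{j}c_L^{\ell}(\sin\theta)^{(2-j)/2}P_{L+(j-2)/2}^{-(\ell+(j-2)/2)}(\cos\theta)$ (extended continuously to $\theta\in\{0,\pi\}$), $P_\nu^\mu$ are the associated Legendre functions on $(-1,1)$ and ${}_{j}c_L^{\ell}=\left(\frac{2L+j-1}{2}\frac{(L+\ell+j-2)!}{(L-\ell)!}\right)^{1/2}$. Axially symmetric means invariant under simultaneous rotation $\theta_1\mapsto\theta_1+\alpha$ of both arguments for every $\alpha$ (every kernel of the displayed form has this property). *)

(* Defs.v *)
From HB Require Import structures.
From mathcomp Require Import all_boot all_order all_algebra finmap.
From mathcomp Require Import complex.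
From mathcomp Require Import all_classical all_reals all_analysis.
From mathcomp Require showcase.summability.

Set Implicit Arguments.
Unset Strict Implicit.
Unset Printing Implicit Defensive.

Import Order.TTheory GRing.Theory Num.Theory.
Import numFieldNormedType.Exports.

#[global] Open Scope classical_set_scope.
#[global] Open Scope sesquilinear_scope.
#[global] Open Scope complex_scope.
#[global] Open Scope ring_scope.

Definition psdmx (C : numClosedFieldType) (n : nat) (A : 'M[C]_n) : Prop :=
  A \is hermsymmx /\ forall v : 'cV[C]_n, 0 <= (v ^t* *m A *m v) 0 0.

Definition hermitian_kernel (C : numClosedFieldType) (T : Type)
    (Omega : set T) (K : T -> T -> C) : Prop :=
  forall x y, Omega x -> Omega y -> K x y = (K y x)^*%R.

(* A finite set of distinct points is given by an injective family. *)
Definition positive_definite (C : numClosedFieldType) (T : Type)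
    (Omega : set T) (K : T -> T -> C) : Prop :=
  hermitian_kernel Omega K /\
  forall (n : nat) (xi : 'I_n -> T), injective xi ->
    (forall i, Omega (xi i)) -> psdmx (\matrix_(i, j) K (xi i) (xi j)).

(* Unconditional summation: s is the limit of the finite partial sums along
   the finite subsets of the index type, directed by inclusion. *)
Definition has_sum (I : choiceType) (K : numFieldType) (D : set I)
    (f : I -> K) (s : K) : Prop :=
  summability.partial_sum (f \_ D) @ summability.totally --> s.

Section SpecialFunctions.
Variable R : realType.
Implicit Types x z a b c nu mu theta : R.

(* 1 / Gamma(x) by Gauss' product; it is entire and vanishes at 0, -1, -2, ... *)
Definition rgamma x : R :=
  limn (fun n : nat =>
    (\prod_(i < n.+1) (x + i%:R)) / ((n`!)%:R * (n%:R `^ x))).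

Definition pochhammer a (k : nat) : R := \prod_(i < k) (a + i%:R).

(* The regularized Gauss function F(a, b; c; z) / Gamma(c), for `|z| < 1.
   It makes sense for c = 0, -1, -2, ... as well. *)
Definition hypergeom_reg a b c z : R :=
  limn (series (fun k : nat =>
    pochhammer a k * pochhammer b k * rgamma (c + k%:R) / (k`!)%:R * z ^+ k)).

(* P_nu^mu on the cut -1 < x < 1. The regularized series covers the positive
   integer orders mu, which occur below when l1 < 0. *)
Definition legendreP nu mu x : R :=
  ((1 + x) / (1 - x)) `^ (mu / 2) *
  hypergeom_reg (nu + 1) (- nu) (1 - mu) ((1 - x) / 2).

Definition legendre_coef (j : nat) (L l : int) : R :=
  Num.sqrt ((2 * L%:~R + j%:R - 1) / 2 *
            ((absz (L + l + j%:Z - 2)%R)`!)%:R / ((absz (L - l)%R)`!)%:R).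

Definition Ptilde_in (j : nat) (L l : int) theta : R :=
  let h : R := (j%:R - 2) / 2 in
  legendre_coef j L l * (sin theta) `^ ((2 - j%:R) / 2) *
  legendreP (L%:~R + h) (- (l%:~R + h)) (cos theta).

Definition Ptilde (j : nat) (L l : int) theta : R :=
  if 0 < theta < pi then Ptilde_in j L l theta
  else lim (Ptilde_in j L l t @[t --> within `]0, pi[ (nbhs theta)]).

End SpecialFunctions.

Section Sphere.
Variables (R : realType) (d : nat).

(* The unit sphere S^(d-1) of R^d. *)
Definition sphere : set 'rV[R]_d := [set x | \sum_(i < d) x 0 i ^+ 2 = 1].

(* Angles are families theta : nat -> R of which only theta 1, ..., theta d.-1
   matter. The column i of a row vector is the coordinate of index i + 1. *)
Definition polar_domain : set (nat -> R) :=
  [set theta | 0 <= theta 1%N < 2 * pi /\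
     forall j, (2 <= j < d)%N -> 0 <= theta j <= pi].

Definition polar (theta : nat -> R) : 'rV[R]_d :=
  \row_(i < d)
    ((match nat_of_ord i with
      | 0%N => cos (theta 1%N)
      | 1%N => sin (theta 1%N)
      | k => cos (theta k)
      end) * \prod_(maxn i.+1 2 <= j < d) sin (theta j)).

(* Some polar coordinates of xi. They are unique up to the angles that become
   irrelevant when sin (theta j) = 0 for a larger j, and the spherical
   harmonics below do not depend on that choice. *)
Definition polar_angles (xi : 'rV[R]_d) : nat -> R :=
  xget (fun=> 0) [set theta | polar_domain theta /\ polar theta = xi].

Definition rotate_angle (alpha : R) (theta : nat -> R) : nat -> R :=
  fun j => if j == 1%N then theta 1%N + alpha else theta j.

(* As polar maps polar_domain onto the sphere, this quantifies over all pairs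
   of points; polar is 2 pi-periodic in theta 1, so no reduction is needed. *)
Definition axially_symmetric (K : 'rV[R]_d -> 'rV[R]_d -> R[i]) : Prop :=
  forall (alpha : R) (theta theta' : nat -> R),
    polar_domain theta -> polar_domain theta' ->
    K (polar (rotate_angle alpha theta)) (polar (rotate_angle alpha theta')) =
    K (polar theta) (polar theta').

(* The surface area of S^(d-1): the integral of the area element
   \prod_(2 <= j < d) sin (theta j) ^+ j.-1 over the domain of the angles. *)
Definition sphere_area : R :=
  2 * pi *
  \prod_(2 <= j < d) \int[lebesgue_measure]_(t in `[0, pi]) (sin t ^+ j.-1).

Definition harmonic_dim (n : nat) : R :=
  if n == 0%N then 1
  else ((2 * n + d - 2) * (n + d - 3)`!)%:R / (n`! * (d - 2)`!)%:R.

(* A multi-index (l_2, ..., l_(d-1)); together with l1, the entry of index j,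
   for 1 <= j <= d - 1, is lidx l1 l j. *)
Definition lidx (l1 : int) (l : (d - 2).-tuple int) (j : nat) : int :=
  nth 0 (l1 :: l) j.-1.

Definition Lambda (l1 : int) : set ((d - 2).-tuple int) :=
  [set l | path <=%R `|l1| l].

Definition spherical_harmonic (l1 : int) (l : (d - 2).-tuple int) (xi : 'rV[R]_d) :
    R[i] :=
  let theta := polar_angles xi in
  ((Num.sqrt (2 * pi))^-1)%:C *
  (cos (l1%:~R * theta 1%N) +i* sin (l1%:~R * theta 1%N)) *
  (\prod_(2 <= j < d) Ptilde j (lidx l1 l j) (lidx l1 l j.-1) (theta j))%:C.

End Sphere.

Arguments sphere R d : clear implicits.
Arguments Lambda d l1 : clear implicits.
Arguments lidx d l1 l j : clear implicits.
Arguments spherical_harmonic {R} d l1 l xi.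

(* Main.v *)
(* For v and points xi_i, put w_l = \sum_i conj(v_i) Y_(l1, l)(xi_i). By linearity
   of has_sum, the l1-part of the quadratic form of (K(xi_i, xi_j)) at v is the
   sum of c_(l1)(l, l') w_l conj(w_l'). Along the squares of initial segments of
   the enumeration its partial sums are values of the quadratic forms of the
   A_(l1)^k, hence nonnegative, and nonnegativity passes to the limit. *)
Require Import Defs.
From HB Require Import structures.
From mathcomp Require Import all_boot all_order all_algebra finmap.
From mathcomp Require Import complex.
From mathcomp Require Import all_classical all_reals all_analysis.
From mathcomp Require Import ring.
From mathcomp Require showcase.summability.

Set Implicit Arguments.
Unset Strict Implicit.
Unset Printing Implicit Defensive.

Import Order.TTheory GRing.Theory Num.Theory.
Import numFieldNormedType.Exports.
#[local] Existing Instance summability.totally_filter.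

(* `|x| - x vanishes exactly when x is nonnegative and is continuous in x, which
   makes the nonnegative cone closed although the order is only partial. *)
Lemma frequently_ge0_lim (K : numFieldType) (T : Type) (F : set_system T)
    (FF : Filter F) (f : T -> K) (s : K) :
  f x @[x --> F] --> s ->
  (forall A : set T, F A -> exists2 x, A x & 0 <= f x) -> 0 <= s.
Proof.
move=> fs freq; apply: contraT; rewrite ger0_def -subr_eq0 => ns.
(* Half the gap, since the distance from [s] to [f x] enters twice: directly and through the
   absolute values. *)
have e0 : 0 < `| `|s| - s | / 2 by rewrite divr_gt0 ?normr_gt0.
have [x /= sfx fx0] := freq _ ((cvgrPdist_lt _ _).1 fs _ e0).
suff : `| `|s| - s | < `| `|s| - s | by rewrite ltxx.
have -> : `|s| - s = (`|s| - `|f x|) - (s - f x).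
  by rewrite (ger0_norm fx0) opprB addrA subrK.
apply: le_lt_trans (ler_normB _ _) _; rewrite [ltRHS]splitr.
have -> : `|s| - `|f x| - (s - f x) = `|s| - s.
  by rewrite (ger0_norm fx0) opprB addrA subrK.
by rewrite ltrD // (le_lt_trans (ler_dist_dist _ _)).
Qed.

Lemma partial_sumE (I : choiceType) (V : zmodType) (f : I -> V) (A : {fset I}) :
  summability.partial_sum f A = \sum_(i <- A) f i.
Proof. by rewrite big_seq_fsetE. Qed.

(** A family of finite sets cofinal under inclusion meets every set of the filter [totally], so
    signs along such a family already decide the limit. *)
Lemma has_sum_ge0 (I : choiceType) (K : numFieldType) (D : set I) (f : I -> K)
    (s : K) :
  has_sum D f s ->
  (forall A : {fset I}, exists2 B : {fset I}, (A `<=` B)%fset &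
     0 <= \sum_(i <- B) (f \_ D) i) ->
  0 <= s.
Proof.
move=> fs fB.
apply: (@frequently_ge0_lim _ _ _ _ (summability.partial_sum (f \_ D)) _ fs).
move=> P [A _ AP]; have [B AB B0] := fB A.
by exists B; [exact: AP|rewrite partial_sumE].
Qed.

(** Used twice below: for the outer sum over [l1] and for the inner sum at fixed [l1]. *)
Lemma has_sum_lincomb (I : choiceType) (K : numFieldType) (D : set I)
    (J : finType) (a : J -> K) (f : J -> I -> K) (s : J -> K) :
  (forall j, has_sum D (f j) (s j)) ->
  has_sum D (fun i => \sum_j a j * f j i) (\sum_j a j * s j).
Proof.
move=> fs; rewrite /has_sum.
have -> : summability.partial_sum ((fun i => \sum_j a j * f j i) \_ D) =
    (fun A => \sum_j a j * summability.partial_sum (f j \_ D) A).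
  apply/funext => A; rewrite /= partial_sumE.
  transitivity (\sum_j \sum_(i <- A) a j * (f j \_ D) i); last first.
    by apply: eq_bigr => j _; rewrite partial_sumE mulr_sumr.
  rewrite exchange_big /=; apply: eq_bigr => i _; rewrite /patch.
  by case: ifP => // _; rewrite big1 // => j _; rewrite mulr0.
apply: cvg_big => [|j _]; first exact: add_continuous.
exact: cvgMl_tmp (fs j).
Qed.

Lemma quadratic_formE (C : numClosedFieldType) (n : nat)
    (F : 'I_n -> 'I_n -> C) (v : 'cV[C]_n) :
  (v ^t* *m \matrix_(i, j) F i j *m v) 0 0 =
  \sum_(p : 'I_n * 'I_n) (v p.1 0)^* * v p.2 0 * F p.1 p.2.
Proof.
rewrite -(pair_bigA _ (fun i j => (v i 0)^* * v j 0 * F i j)) /= exchange_big.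
rewrite mxE; apply: eq_bigr => j _; rewrite mxE mulr_suml.
by apply: eq_bigr => i _; rewrite !mxE mulrAC.
Qed.

(* Every finite index set sits in a finite index set whose part in D `*` D is a
   square {e 0, ..., e k}^2, and the partial sum over a square is a value of the
   quadratic form of a leading block. *)
Lemma has_sum_psd_ge0 (C : numClosedFieldType) (I : choiceType) (D : set I)
    (e : nat -> I) (c : I -> I -> C) (w : I -> C) (s : C) :
  set_bij [set: nat] D e ->
  (forall k : nat, psdmx (\matrix_(a < k.+1, a' < k.+1) c (e a) (e a'))) ->
  has_sum (D `*` D) (fun p => c p.1 p.2 * w p.1 * (w p.2)^*) s -> 0 <= s.
Proof.
move=> [eD e_inj e_surj] psd /has_sum_ge0; apply => A.
have [N DN] : exists N : nat, forall p, p \in A -> D p.1 -> D p.2 ->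
    exists2 q : nat * nat, (q.1 <= N)%N && (q.2 <= N)%N & p = (e q.1, e q.2).
  (* Pairs with a component outside [D] get the arbitrary value [(0, 0)], so that [q] is total and
     [N] can be a maximum over [A]. *)
  have index p : exists q : nat * nat,
      D p.1 -> D p.2 -> p = (e q.1, e q.2).
    have [D1|nD1] := pselect (D p.1); last by exists (0, 0)%N.
    have [D2|nD2] := pselect (D p.2); last by exists (0, 0)%N.
    have [[a _ pa] [b _ pb]] := (e_surj _ D1, e_surj _ D2).
    by exists (a, b) => _ _; rewrite /= pa pb; case: (p).
  have [q qP] := choice index.
  exists (\max_(p <- A) maxn (q p).1 (q p).2) => p pA D1 D2.
  exists (q p); last exact: qP.
  rewrite -geq_max.
  exact: (@leq_bigmax_seq _ _ xpredT (fun r => maxn (q r).1 (q r).2)).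
set sq := [seq (e a, e b) | a <- index_iota 0 N.+1, b <- index_iota 0 N.+1].
pose B := seq_fset tt sq.
exists (A `|` B)%fset; first exact: fsubsetUl.
(* A pair of [A] outside [B] has a component outside [D], where the patched summand is 0; only the
   sum over [B] remains. *)
rewrite -(big_fset_incl _ (fsubsetUr A B)) => [|p]; last first.
  rewrite inE => /orP[pA|->//] pB; rewrite /patch; case: ifPn => //.
  move=> /set_mem[D1 D2]; have [[a b] /andP[aN bN] pE] := DN _ pA D1 D2.
  case/negP: pB; rewrite seq_fsetE pE.
  by apply: (allpairs_f (fun a b => (e a, e b))); rewrite mem_index_iota.
have sq_uniq : uniq sq.
  apply: allpairs_uniq; rewrite ?/index_iota ?iota_uniq // => -[a b] [a' b'] _ _ /= [].
  have eI : injective e by move=> x y; apply: e_inj; rewrite inE.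
  by move=> /eI -> /eI ->.
rewrite (perm_big sq); last first.
  by apply: uniq_perm => [|//|p]; [exact: fset_uniq|rewrite seq_fsetE].
rewrite big_allpairs_dep big_mkord.
(* [psd N] is about the block of indices 0, ..., N. The test vector is conjugated because the form
   conjugates its left factor, whereas the summand conjugates the second [w]. *)
have [_ /(_ (\col_a (w (e a))^*))] := psd N.
rewrite quadratic_formE; congr (0 <= _).
rewrite -(pair_bigA _ (fun i j : 'I_N.+1 =>
  ((\col_a (w (e a))^* : 'cV[C]_N.+1) i 0)^* *
  (\col_a (w (e a))^* : 'cV[C]_N.+1) j 0 * c (e i) (e j))) /=.
apply: eq_bigr => a _; rewrite big_mkord.
apply: eq_bigr => b _; rewrite !mxE conjCK /patch mem_set.
  by rewrite [LHS]mulrC mulrA.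
by split; apply: eD.
Qed.

Theorem proposition1 (R : realType) (d : nat) (hd : (3 <= d)%N)
    (K : 'rV[R]_d -> 'rV[R]_d -> R[i])
    (c : int -> (d - 2).-tuple int -> (d - 2).-tuple int -> R[i])
    (e : int -> nat -> (d - 2).-tuple int)
    (hK_herm : hermitian_kernel (sphere R d) K)
    (hK_axial : axially_symmetric K)
    (hK_series : forall xi zeta, sphere R d xi -> sphere R d zeta ->
      exists S : int -> R[i],
        (forall l1 : int,
           has_sum (Lambda d l1 `*` Lambda d l1)
             (fun p => c l1 p.1 p.2 * spherical_harmonic d l1 p.1 xi
                       * (spherical_harmonic d l1 p.2 zeta)^*%R)
             (S l1)) /\
        has_sum setT S (K xi zeta))
    (hc : (\esum_(l1 in [set: int])
             \esum_(p in Lambda d l1 `*` Lambda d l1)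
               (complex.Re `|c l1 p.1 p.2| *
                (Num.sqrt (harmonic_dim R d (absz (lidx d l1 p.1 d.-1)) *
                           harmonic_dim R d (absz (lidx d l1 p.2 d.-1)))
                 / sphere_area R d))%:E < +oo)%E)
    (he_bij : forall l1 : int, set_bij [set: nat] (Lambda d l1) (e l1))
    (he_mono : forall (l1 : int) (a' a : nat), (a' < a)%N ->
      lidx d l1 (e l1 a') d.-1 <= lidx d l1 (e l1 a) d.-1)
    (hA : forall (l1 : int) (k : nat), (1 <= k)%N ->
      psdmx (\matrix_(a < k, a' < k) c l1 (e l1 a) (e l1 a'))) :
  positive_definite (sphere R d) K.
Proof.
split=> // n xi _ xiS; split=> [|v].
  apply/is_hermitianmxP; rewrite expr0 scale1r; apply/matrixP => i j.
  by rewrite !mxE; exact: hK_herm.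
rewrite quadratic_formE.
have [S SP] := choice (fun p : 'I_n * 'I_n =>
  hK_series _ _ (xiS p.1) (xiS p.2)).
pose a (p : 'I_n * 'I_n) : R[i] := (v p.1 0)^* * v p.2 0.
have /has_sum_ge0 := has_sum_lincomb (a := a) (fun p => (SP p).2).
apply=> A; exists A => //.
apply: sumr_ge0 => l1 _; rewrite patchT ?inE //.
pose w l := \sum_i (v i 0)^* * spherical_harmonic d l1 l (xi i).
apply: (@has_sum_psd_ge0 _ _ (Lambda d l1) (e l1) (c l1) w) => // [k|].
  exact: hA.
have := has_sum_lincomb (a := a) (fun p => (SP p).1 l1).
congr has_sum; apply/funext => p.
(* The double sum over points factors: the index [i] gathers into [w p.1], the index [j] into the
   conjugate of [w p.2]. *)
rewrite /w rmorph_sum -mulrA mulr_suml mulr_sumr.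
rewrite -(pair_bigA _ (fun i j => (v i 0)^* * v j 0 *
  (c l1 p.1 p.2 * spherical_harmonic d l1 p.1 (xi i) *
   (spherical_harmonic d l1 p.2 (xi j))^*))) /=.
apply: eq_bigr => i _; rewrite !mulr_sumr; apply: eq_bigr => j _.
by rewrite [in RHS]rmorphM /= conjCK; ring.
Qed.
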